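(* Let $R$ be a one-dimensional reduced local ring with canonical module $\omega_R$ (not assumed to be Gorenstein or a domain), and let $M$ be a finitely generated torsionfree $R$-module such that $\operatorname{Ext}^1_R(M,M)=0$ and $\operatorname{Ext}^2_R(\operatorname{Tr}M,M^\dagger)=0$. Then $M$ is free.
   Context: All rings are commutative, unital and Noetherian. $M^\dagger=\operatorname{Hom}_R(M,\omega_R)$ is the canonical dual, and $(-)^*=\operatorname{Hom}_R(-,R)$. The (Auslander) transpose $\operatorname{Tr}M$ of a finitely generated module $M$ over a local ring $R$ is the cokernel of the dual map $F^*\to G^*$, where $G\to F\to M\to 0$ is a minimal free presentation of $M$; it is unique up to isomorphism. (A one-dimensional reduced local ring is Cohen-Macaulay.) *)

(* Defs.v *)
From HB Require Import structures.
From mathcomp Require Import all_boot all_order all_algebra.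
From mathcomp Require Import boolp classical_sets.

Set Implicit Arguments.
Unset Strict Implicit.
Unset Printing Implicit Defensive.

Import GRing.Theory.

Local Open Scope classical_set_scope.
Local Open Scope ring_scope.

Section Rings.
Variable R : comNzRingType.

Definition is_ideal (I : set R) :=
  [/\ I 0, forall x y, I x -> I y -> I (x + y) & forall a x, I x -> I (a * x)].

Definition is_prime_ideal (p : set R) :=
  [/\ is_ideal p, ~ p 1 & forall x y, p (x * y) -> p x \/ p y].

Definition is_maximal_ideal (m : set R) :=
  [/\ is_ideal m, ~ m 1 &
    forall I : set R, is_ideal I -> ~ I 1 -> m `<=` I -> I = m].

Definition is_local (m : set R) :=
  is_maximal_ideal m /\ forall n : set R, is_maximal_ideal n -> n = m.

Definition noetherian :=
  forall I : set R, is_ideal I ->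
    exists (n : nat) (g : 'I_n -> R),
      I = [set x | exists a : 'I_n -> R, x = \sum_i a i * g i].

Definition reduced := forall (x : R) (n : nat), x ^+ n = 0 -> x = 0.

Definition prime_chain (n : nat) (p : nat -> set R) :=
  (forall i, (i <= n)%N -> is_prime_ideal (p i)) /\
  (forall i, (i < n)%N -> p i `<` p i.+1).

Definition krull_dim (n : nat) :=
  (exists p, prime_chain n p) /\
  (forall k p, prime_chain k p -> (k <= n)%N).

Definition nonzerodivisor (r : R) := forall x : R, r * x = 0 -> x = 0.

End Rings.

Arguments noetherian R : clear implicits.
Arguments reduced R : clear implicits.
Arguments krull_dim R n : clear implicits.

Definition HomMod (R : comNzRingType) (M N : lmodType R) := {linear M -> N}.

Section HomModule.
Variables (R : comNzRingType) (M N : lmodType R).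

HB.instance Definition _ := gen_eqMixin (HomMod M N).
HB.instance Definition _ := gen_choiceMixin (HomMod M N).

Implicit Types (f g h : HomMod M N).

Lemma homP f g : (forall x, f x = g x) -> f = g.
Proof.
case: f g => [f [[f1] [f2]]] [g [[g1] [g2]]] /= /funext fg.
case: _ / fg in g1 g2 *.
by rewrite (Prop_irrelevance f1 g1) (Prop_irrelevance f2 g2).
Qed.

Definition hom_zero : HomMod M N := \0.
Definition hom_opp f : HomMod M N := \- f.
Definition hom_add f g : HomMod M N := f \+ g.
Definition hom_scale (a : R) f : HomMod M N := a \*: f.

Fact hom_addA : associative hom_add.
Proof. by move=> f g h; apply: homP => x; apply: addrA. Qed.
Fact hom_addC : commutative hom_add.
Proof. by move=> f g; apply: homP => x; apply: addrC. Qed.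
Fact hom_add0 : left_id hom_zero hom_add.
Proof. by move=> f; apply: homP => x; apply: add0r. Qed.
Fact hom_addN : left_inverse hom_zero hom_opp hom_add.
Proof. by move=> f; apply: homP => x; apply: addNr. Qed.

HB.instance Definition _ :=
  GRing.isZmodule.Build (HomMod M N) hom_addA hom_addC hom_add0 hom_addN.

Fact hom_scaleA a b f : hom_scale a (hom_scale b f) = hom_scale (a * b) f.
Proof. by apply: homP => x; apply: scalerA. Qed.
Fact hom_scale1 : left_id 1 hom_scale.
Proof. by move=> f; apply: homP => x; apply: scale1r. Qed.
Fact hom_scaleDr : right_distributive hom_scale +%R.
Proof. by move=> a f g; apply: homP => x; apply: scalerDr. Qed.
Fact hom_scaleDl f : {morph hom_scale^~ f : a b / a + b}.
Proof. by move=> a b; apply: homP => x; apply: scalerDl. Qed.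

HB.instance Definition _ := GRing.Zmodule_isLmodule.Build R (HomMod M N)
  hom_scaleA hom_scale1 hom_scaleDr hom_scaleDl.

End HomModule.

Section Modules.
Variable R : comNzRingType.
Implicit Types (M N C E T k : lmodType R) (m : set R).

Definition surjective_map (A B : Type) (f : A -> B) := forall y, exists x, f x = y.

Definition fin_gen M :=
  exists (n : nat) (f : {linear 'rV[R]_n -> M}), surjective_map f.

(* Finite bases suffice: only finitely generated modules are considered. *)
Definition is_free M :=
  exists (n : nat) (f : {linear 'rV[R]_n -> M}), bijective f.

Definition torsionfree M :=
  forall (r : R) (x : M), nonzerodivisor r -> r *: x = 0 -> x = 0.

Definition residue_field m k :=
  exists f : {linear R^o -> k},
    surjective_map f /\ (forall r : R, f r = 0 <-> m r).

Definition is_projective (P : lmodType R) :=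
  forall (A B : lmodType R) (f : {linear A -> B}) (g : {linear P -> B}),
    surjective_map f -> exists h : {linear P -> A}, forall x, f (h x) = g x.

Definition is_injective (J : lmodType R) :=
  forall (A B : lmodType R) (f : {linear A -> B}) (g : {linear A -> J}),
    injective f -> exists h : {linear B -> J}, forall x, h (f x) = g x.

(* ... -> P 2 -> P 1 -> P 0 -> M -> 0 *)
Record proj_resolution M := ProjResolution {
  res_mod :> nat -> lmodType R;
  res_diff : forall i, {linear res_mod i.+1 -> res_mod i};
  res_aug : {linear res_mod 0%N -> M};
  res_projective : forall i, is_projective (res_mod i);
  res_aug_surj : surjective_map res_aug;
  res_exact0 : forall x, res_aug x = 0 <-> exists y, x = res_diff 0 y;
  res_exactS : forall i x,
    res_diff i x = 0 <-> exists y, x = res_diff i.+1 y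
}.

Section Ext.
Variables (M N : lmodType R) (P : proj_resolution M).

Definition cocycle (i : nat) (f : HomMod (P i) N) :=
  forall x, f (res_diff P i x) = 0.

Definition coboundary (i : nat) : HomMod (P i) N -> Prop :=
  match i return HomMod (P i) N -> Prop with
  | 0 => fun f => f = 0
  | j.+1 => fun f => exists g : HomMod (P j) N, forall x, f x = g (res_diff P j x)
  end.

End Ext.

(* Ext^i_R(M, N) = 0.  The cohomology of Hom_R(P, N) does not depend on P, so
   quantifying over all projective resolutions P of M is the same as fixing
   one. *)
Definition Ext_zero (i : nat) M N :=
  forall (P : proj_resolution M) (f : HomMod (P i) N),
    cocycle f -> coboundary f.

(* Ext^i_R(M, N) is isomorphic to E: phi maps cocycles onto E, linearly, with
   kernel the coboundaries (its values elsewhere are irrelevant). *)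
Definition Ext_iso (i : nat) M N E :=
  forall P : proj_resolution M, exists phi : HomMod (P i) N -> E,
    [/\ forall (a : R) (f g : HomMod (P i) N), cocycle f -> cocycle g ->
          phi (a *: f + g) = a *: phi f + phi g,
        forall e : E, exists2 f, cocycle f & phi f = e
      & forall f, cocycle f -> (phi f = 0 <-> coboundary f)].

(* The submodule (s_0, ..., s_(n-1)) C. *)
Definition seq_span (s : seq R) C : set C :=
  [set c | exists g : 'I_(size s) -> C, c = \sum_(i < size s) s`_i *: g i].

Definition regular_seq (s : seq R) C :=
  (forall i, (i < size s)%N -> forall c : C,
     seq_span (take i s) (s`_i *: c) -> seq_span (take i s) c) /\
  (exists c : C, ~ seq_span s c).

Definition has_depth m C (n : nat) :=
  (exists s : seq R,
     [/\ size s = n, forall x, x \in s -> m x & regular_seq s C]) /\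
  (forall s : seq R,
     (forall x, x \in s -> m x) -> regular_seq s C -> (size s <= n)%N).

(* 0 -> C -> J 0 -> J 1 -> ... -> J n -> 0 *)
Definition finite_inj_dim C :=
  exists (n : nat) (J : nat -> lmodType R)
         (d : forall i, {linear J i -> J i.+1}) (e : {linear C -> J 0%N}),
    [/\ forall i, is_injective (J i),
        forall i, (n < i)%N -> forall y : J i, y = 0,
        injective e,
        forall y, d 0%N y = 0 <-> exists x, y = e x
      & forall i y, d i.+1 y = 0 <-> exists x, y = d i x].

Definition max_CohenMacaulay m C :=
  fin_gen C /\ exists2 d : nat, krull_dim R d & has_depth m C d.

(* Type one: dim_k Ext^t_R(k, C) = 1 for t = depth C, k = R/m.  This Ext is
   killed by m, so it has k-dimension one iff it is R-isomorphic to k. *)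
Definition type_one m C :=
  exists t : nat, has_depth m C t /\
    exists k : lmodType R, residue_field m k /\ Ext_iso t k C k.

(* A canonical module of a Cohen-Macaulay local ring (R, m). *)
Definition canonical_module m C :=
  [/\ max_CohenMacaulay m C, type_one m C & finite_inj_dim C].

(* T is a transpose of M: coker (Hom(F, R) -> Hom(G, R)) for a minimal free
   presentation G -u-> F -p-> M -> 0, with F = R^a and G = R^b; minimality
   says ker p <= m F and ker u <= m G. *)
Definition is_transpose m M T :=
  exists (a b : nat) (u : {linear 'rV[R]_b -> 'rV[R]_a})
         (p : {linear 'rV[R]_a -> M}),
    [/\ surjective_map p,
        forall y, p y = 0 <-> exists x, y = u x,
        forall y, p y = 0 -> forall j, m (y 0 j),
        forall x, u x = 0 -> forall j, m (x 0 j)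
      & exists q : {linear HomMod 'rV[R]_b R^o -> T},
          surjective_map q /\
          forall h : HomMod 'rV[R]_b R^o, q h = 0 <->
            exists f : HomMod 'rV[R]_a R^o, forall x, h x = f (u x)].

End Modules.

(* Main.v *)
(* Write M^dagger = Hom(M, omega) and M^* = Hom(M, R), let F -> M be the given
   free cover, E = End M, and let T be the image of M^* (x) M in E.  The module
   M is free as soon as the identity lies in T.  As R is reduced, E / T is
   torsion, so if T <> E then some e = r id in E \ T satisfies m e <= T.
   Since omega has injective dimension at most 1 and E embeds in a free module,
   Ext^1(T + R e, omega) = 0, whereas Ext^1(R / m, omega) <> 0; hence some map
   T -> omega does not extend to T + R e.  On the other hand Ext^2(Tr M, M^dagger)
   is the cokernel of M (x) M^dagger -> Hom(M^*, M^dagger), so any map T -> omega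
   has the form f (x) y |-> sum_i phi_i (f (x_i) y) with x_i in M and phi_i in
   M^dagger, and extends to E by t |-> sum_i phi_i (t x_i). *)
Require Import Defs.
From HB Require Import structures.
From mathcomp Require Import all_boot all_order all_algebra.
From mathcomp Require Import perm.
From mathcomp Require Import boolp classical_sets.

Set Implicit Arguments.
Unset Strict Implicit.
Unset Printing Implicit Defensive.

Import GRing.Theory.

Local Open Scope classical_set_scope.
Local Open Scope ring_scope.

(** * Linear maps from linear relations, submodules, and extension into injective modules *)

Section LinearRelations.
Variable R : comNzRingType.
Implicit Types V W : lmodType R.

Lemma linear_of_fun V W (f : V -> W) :
  (forall a x y, f (a *: x + y) = a *: f x + f y) ->
  exists h : {linear V -> W}, forall x, h x = f x.
Proof.
move=> fL.
by pose h : {linear V -> W} := HB.pack f (GRing.isLinear.Build R V W *:%R f fL);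
  exists h.
Qed.

Lemma linear_of_rel V W (G : V -> W -> Prop) :
  (forall v, exists w, G v w) ->
  (forall a v w v' w', G v w -> G v' w' -> G (a *: v + v') (a *: w + w')) ->
  (forall w, G 0 w -> w = 0) ->
  exists h : {linear V -> W}, forall v, G v (h v).
Proof.
move=> /choice[f fG] GL G0.
have Gu v w w' : G v w -> G v w' -> w = w'.
  move=> Gw Gw'; have := GL (-1) _ _ _ _ Gw Gw'.
  by rewrite !scaleN1r addNr => /G0 /eqP; rewrite addrC subr_eq0 => /eqP.
have [|h hE] := @linear_of_fun V W f; last by exists h => v; rewrite hE.
by move=> a x y; apply: Gu (fG _) _; apply: GL.
Qed.

Definition submodule V (S : set V) :=
  S 0 /\ forall (a : R) x y, S x -> S y -> S (a *: x + y).

Lemma submoduleD V (S : set V) x y : submodule S -> S x -> S y -> S (x + y).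
Proof. by case=> _ SL Sx Sy; rewrite -(scale1r x); apply: SL. Qed.

Lemma submoduleZ V (S : set V) a x : submodule S -> S x -> S (a *: x).
Proof. by case=> S0 SL Sx; rewrite -(addr0 (a *: x)); apply: SL. Qed.

Lemma submoduleB V (S : set V) x y : submodule S -> S x -> S y -> S (x - y).
Proof.
by move=> SS Sx Sy; apply: submoduleD => //; rewrite -scaleN1r; apply: submoduleZ.
Qed.

Lemma submodule_sum V (S : set V) (I : finType) (P : pred I) (F : I -> V) :
  submodule S -> (forall i, P i -> S (F i)) -> S (\sum_(i | P i) F i).
Proof.
move=> SS SF; apply: big_ind => //; first by case: SS.
by move=> x y; apply: submoduleD.
Qed.

Lemma submodule0 V : submodule [set 0 : V].
Proof. by split=> // a x y -> ->; rewrite scaler0 addr0. Qed.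

(** Makes a submodule, given as a set, a module in its own right, so that injectivity applies to
    maps defined only there. *)
Record submod_type V (S : set V) (SS : submodule S) :=
  Submod { submod_val : V; submod_valP : S submod_val }.

Section SubmodLmod.
Variables (V : lmodType R) (S : set V) (SS : submodule S).
Local Notation T := (submod_type SS).

HB.instance Definition _ := gen_eqMixin T.
HB.instance Definition _ := gen_choiceMixin T.

Lemma submod_val_inj : injective (@submod_val V S SS).
Proof.
move=> [x Sx] [y Sy] /= xy; case: _ / xy in Sy *.
by rewrite (Prop_irrelevance Sx Sy).
Qed.

Let zero : T := Submod SS (proj1 SS).
Let add (x y : T) : T :=
  Submod SS (submoduleD SS (submod_valP x) (submod_valP y)).
Let scale a (x : T) : T := Submod SS (submoduleZ a SS (submod_valP x)).
Let opp (x : T) : T := scale (-1) x.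

Fact submod_addA : associative add.
Proof. by move=> x y z; apply: submod_val_inj; apply: addrA. Qed.
Fact submod_addC : commutative add.
Proof. by move=> x y; apply: submod_val_inj; apply: addrC. Qed.
Fact submod_add0 : left_id zero add.
Proof. by move=> x; apply: submod_val_inj; apply: add0r. Qed.
Fact submod_addN : left_inverse zero opp add.
Proof. by move=> x; apply: submod_val_inj; rewrite /= scaleN1r addNr. Qed.

HB.instance Definition _ :=
  GRing.isZmodule.Build T submod_addA submod_addC submod_add0 submod_addN.

Fact submod_scaleA a b (x : T) : scale a (scale b x) = scale (a * b) x.
Proof. by apply: submod_val_inj; apply: scalerA. Qed.
Fact submod_scale1 : left_id 1 scale.
Proof. by move=> x; apply: submod_val_inj; apply: scale1r. Qed.
Fact submod_scaleDr : right_distributive scale +%R.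
Proof. by move=> a x y; apply: submod_val_inj; apply: scalerDr. Qed.
Fact submod_scaleDl (x : T) : {morph scale^~ x : a b / a + b}.
Proof. by move=> a b; apply: submod_val_inj; apply: scalerDl. Qed.

HB.instance Definition _ := GRing.Zmodule_isLmodule.Build R T
  submod_scaleA submod_scale1 submod_scaleDr submod_scaleDl.

End SubmodLmod.

(** The graph is a submodule of [V * J] whose first projection is injective by the last hypothesis
    on [G]; extend the second projection along the first. *)
Lemma injective_extend_rel (J V : lmodType R) (G : V -> J -> Prop) :
  is_injective J -> G 0 0 ->
  (forall a v w v' w', G v w -> G v' w' -> G (a *: v + v') (a *: w + w')) ->
  (forall w, G 0 w -> w = 0) ->
  exists h : {linear V -> J}, forall v w, G v w -> h v = w.
Proof.
move=> injJ G00 GL G0.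
have SG : submodule [set z : (V * J)%type | G z.1 z.2].
  by split=> // a [v w] [v' w'] /=; apply: GL.
have [f fE] := @linear_of_fun (submod_type SG) V (fun z => (submod_val z).1)
  (fun _ _ _ => erefl).
have [g gE] := @linear_of_fun (submod_type SG) J (fun z => (submod_val z).2)
  (fun _ _ _ => erefl).
have finj : injective f.
  move=> x y /eqP; rewrite -subr_eq0 -linearB => /eqP fxy.
  apply/eqP; rewrite -subr_eq0; apply/eqP; apply: submod_val_inj.
  move: (submod_valP (x - y)) fxy; rewrite fE.
  move: (submod_val (x - y)) => [v w] /= Gvw v0.
  by move: Gvw; rewrite v0 => /G0 ->.
have [h hE] := injJ _ _ f g finj; exists h => v w Gvw.
have := hE (@Submod _ _ SG (v, w) Gvw).
by rewrite fE gE.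
Qed.

(** The rule [k + s *: b |-> s *: y] is well defined on [K + R b] because whatever multiplies [b]
    into [K] kills [y]. *)
Lemma injective_extend_colon (J V : lmodType R) (K : set V) (b : V) (y : J) :
  is_injective J -> submodule K -> (forall s, K (s *: b) -> s *: y = 0) ->
  exists2 h : {linear V -> J}, (forall k, K k -> h k = 0) & h b = y.
Proof.
move=> injJ SK Ky.
pose G v w := exists k s, [/\ K k, v = k + s *: b & w = s *: y].
have [||| h hE] := @injective_extend_rel J V G injJ.
- by exists 0, 0; split; rewrite ?scale0r ?addr0 //; case: SK.
- move=> a _ _ _ _ [k [s [Kk -> ->]]] [k' [s' [Kk' -> ->]]].
  exists (a *: k + k'), (a * s + s'); split; first by case: SK => _; apply.
    by rewrite scalerDr scalerDl -!scalerA addrACA.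
  by rewrite scalerDl scalerA.
- move=> _ [k [s [Kk /eqP + ->]]]; rewrite eq_sym addrC addr_eq0 => /eqP sb.
  by apply: Ky; rewrite sb -scaleN1r; apply: submoduleZ.
exists h => [k Kk|]; apply: hE.
  by exists k, 0; rewrite !scale0r addr0.
by exists 0, 1; rewrite !scale1r add0r; split => //; case: SK.
Qed.

Lemma rV_lift n (A B : lmodType R) (f : {linear A -> B})
    (c : {linear 'rV[R]_n -> B}) :
  (forall z, exists x, f x = c z) ->
  exists h : {linear 'rV[R]_n -> A}, forall z, f (h z) = c z.
Proof.
move=> fc; have [x xE] := choice (fun i : 'I_n => fc (delta_mx 0 i)).
have [|h hE] := @linear_of_fun _ A (fun z : 'rV[R]_n => \sum_i z 0 i *: x i).
  move=> a z z'; rewrite scaler_sumr -big_split; apply: eq_bigr => i _ /=.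
  by rewrite !mxE scalerDl scalerA.
exists h => z; rewrite hE {2}(row_sum_delta z) !linear_sum.
by apply: eq_bigr => i _; rewrite !linearZ /= xE.
Qed.

Lemma rV_projective n : is_projective ('rV[R]_n : lmodType R).
Proof. by move=> A B f g fS; apply: rV_lift => z; apply: fS. Qed.

End LinearRelations.

(** * Noetherian modules, and primes of a reduced local ring of dimension one *)

Section Noetherian.
Variable R : comNzRingType.
Implicit Types V : lmodType R.

Definition noetherian_module V := forall S : set V, submodule S ->
  exists n (g : 'I_n -> V), S = [set v | exists a, v = \sum_i a i *: g i].

(** Without a maximal member, choice gives a strictly increasing chain; its union is finitely
    generated, and the generators already lie in one member. *)
Lemma noetherian_module_max V (F : set (set V)) :
  noetherian_module V -> (forall S, F S -> submodule S) -> F !=set0 ->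
  exists2 S, F S & forall S', F S' -> S `<=` S' -> S' `<=` S.
Proof.
move=> noethV Fsub [S0 FS0]; apply: contrapT => nomax.
have grow (S : {S | F S}) :
    exists S' : {S | F S}, sval S `<=` sval S' /\ ~ (sval S' `<=` sval S).
  case: S => S FS /=; apply: contrapT => noS; apply: nomax.
  exists S => // S' FS' SS'; apply: contrapT => nS'.
  by apply: noS; exists (exist _ S' FS').
have [next nextP] := choice grow.
pose chain k := sval (iter k next (exist _ S0 FS0)).
have chain_le k l : (k <= l)%N -> chain k `<=` chain l.
  move=> /subnK <-; elim: (l - k)%N => // d IH x /IH.
  by apply: (proj1 (nextP _)).
have chainS k : submodule (chain k) by apply: Fsub; apply: (svalP (iter k _ _)).
pose U : set V := [set v | exists k, chain k v].
have SU : submodule U.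
  split; first by exists 0%N; case: (chainS 0%N).
  move=> a x y [k kx] [l ly]; exists (maxn k l).
  case: (chainS (maxn k l)) => _; apply.
    by apply: chain_le kx; apply: leq_maxl.
  by apply: chain_le ly; apply: leq_maxr.
have [n [g UE]] := noethV _ SU.
have /choice[k kE] (i : 'I_n) : exists k, chain k (g i).
  have : U (g i); last by [].
  rewrite UE; exists (fun j => (j == i)%:R).
  rewrite (bigD1 i) //= eqxx scale1r big1 ?addr0 // => j /negPf ->.
  by rewrite scale0r.
have Umax v : U v -> chain (\max_i k i) v.
  rewrite UE => -[a ->]; apply: submodule_sum => // i _.
  by apply: submoduleZ => //; apply: (chain_le (k i)) => //; apply: leq_bigmax.
have [_] := nextP (iter (\max_i k i) next (exist _ S0 FS0)).
by apply=> v vN; apply: Umax; exists (\max_i k i).+1.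
Qed.

Lemma ideal_submodule (I : set R) :
  is_ideal I <-> submodule (I : set (R^o : lmodType R)).
Proof.
split=> [[I0 ID IM]|SI].
  by split=> // a x y Ix Iy; apply: ID => //; apply: IM.
split; first by case: SI.
  by move=> x y; apply: (@submoduleD R R^o I x y SI).
by move=> a x; apply: (@submoduleZ R R^o I a x SI).
Qed.

Hypothesis noethR : noetherian R.

Lemma regular_noetherian : noetherian_module (R^o : lmodType R).
Proof. by move=> I /ideal_submodule /noethR. Qed.

(** Induction on the rank: lifts of generators of the ideal of first coordinates, and generators of
    the part with first coordinate zero, generate [S]. *)
Lemma rV_noetherian n : noetherian_module ('rV[R]_n : lmodType R).
Proof.
elim: n => [|n IH] S SS.
  exists 0%N, (fun=> 0); apply/seteqP; split=> v.
    by move=> _; exists (fun=> 0); rewrite big_ord0; apply/rowP => -[].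
  move=> _; have -> : v = 0 by apply/rowP => -[].
  by case: SS.
pose S' : set 'rV[R]_n := [set w | S (row_mx (0 : 'rV_1) w)].
have SS' : submodule S'.
  rewrite /S'; split=> /= [|a x y Sx Sy]; first by rewrite row_mx0; case: SS.
  have -> : row_mx (0 : 'rV_1) (a *: x + y) = a *: row_mx 0 x + row_mx 0 y.
    by rewrite scale_row_mx add_row_mx scaler0 addr0.
  by case: SS => _; apply.
pose L : set R^o := [set r | exists2 v : 'rV[R]_(1 + n), S v & r = v 0 0].
have SL : submodule L.
  split; first by exists 0; [case: SS | rewrite mxE].
  move=> a _ _ [v Sv ->] [w Sw ->]; exists (a *: v + w).
    by case: SS => _; apply.
  by rewrite !mxE.
have [k [g LE]] := regular_noetherian SL.
have [l [h SE]] := IH _ SS'.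
have /choice[v vP] (i : 'I_k) : exists v : 'rV[R]_(1 + n), S v /\ g i = v 0 0.
  have : L (g i); last by case=> v; exists v.
  rewrite LE; exists (fun j => (j == i)%:R).
  rewrite (bigD1 i) //= eqxx scale1r big1 ?addr0 // => j /negPf ->.
  by rewrite scale0r.
have hS (i : 'I_l) : S (row_mx (0 : 'rV_1) (h i)).
  have : S' (h i); last by [].
  rewrite SE; exists (fun j => (j == i)%:R).
  rewrite (bigD1 i) //= eqxx scale1r big1 ?addr0 // => j /negPf ->.
  by rewrite scale0r.
exists (k + l)%N, (fun i => match split i with
  | inl i => v i | inr i => row_mx (0 : 'rV_1) (h i) end).
apply/seteqP; split=> x.
  move=> Sx; have : L (x 0 0) by exists x.
  rewrite LE => -[a xa]; pose y : 'rV[R]_(1 + n) := x - \sum_i a i *: v i.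
  have Sy : S y.
    apply: submoduleB => //; apply: submodule_sum => // i _.
    by apply: submoduleZ => //; case: (vP i).
  have yE : y = row_mx (0 : 'rV_1) (rsubmx y).
    rewrite -[LHS]hsubmxK; congr row_mx; apply/rowP => i; rewrite ord1 !mxE.
    have -> : lshift n 0 = 0 :> 'I_(1 + n) by apply: val_inj.
    rewrite xa summxE -sumrB big1 // => j _; rewrite mxE.
    by case: (vP j) => _ ->; rewrite subrr.
  have : S' (rsubmx y) by rewrite /S' /= -yE.
  rewrite SE => -[b yb].
  exists (fun i => match split i with inl i => a i | inr i => b i end).
  rewrite big_split_ord /=.
  under eq_bigr do rewrite (unsplitK (inl _)).
  under [X in _ + X]eq_bigr do rewrite (unsplitK (inr _)).
  have -> : \sum_(i < l) b i *: row_mx (0 : 'rV_1) (h i) = y.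
    rewrite yE yb; apply/rowP => i; rewrite summxE -[i]splitK.
    case: (split i) => j /=; rewrite ?row_mxEl ?row_mxEr.
      by rewrite mxE big1 // => t _; rewrite mxE row_mxEl mxE mulr0.
    by rewrite summxE; apply: eq_bigr => t _; rewrite [LHS]mxE row_mxEr [RHS]mxE.
  by rewrite addrC subrK.
move=> [a ->]; apply: submodule_sum => // i _; apply: submoduleZ => //.
by case: (split i) => j; [case: (vP j) | apply: hS].
Qed.

Lemma colon_ideal V (S : set V) (w : V) :
  submodule S -> is_ideal [set s : R | S (s *: w)].
Proof.
move=> SS; split=> /=; first by rewrite scale0r; case: SS.
- by move=> x y Sx Sy; rewrite scalerDl; apply: submoduleD.
- by move=> a x Sx; rewrite -scalerA; apply: submoduleZ.
Qed.

Lemma ideal_max (F : set (set R)) :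
  (forall I, F I -> is_ideal I) -> F !=set0 ->
  exists2 I, F I & forall I', F I' -> I `<=` I' -> I' `<=` I.
Proof.
move=> FI F0; apply: (@noetherian_module_max R^o) => //.
  exact: regular_noetherian.
by move=> I /FI /ideal_submodule.
Qed.

(** An associated prime of [V / S]: among the colon ideals of multiples of [w] outside [S], a
    maximal one is prime. *)
Lemma prime_colon V (S : set V) (w : V) : submodule S -> ~ S w ->
  exists2 r : R, ~ S (r *: w) & is_prime_ideal [set s | S (s *: (r *: w))].
Proof.
move=> SS nSw.
pose F : set (set R) := [set I | exists2 r : R, ~ S (r *: w) &
  I = [set s | S (s *: (r *: w))]].
have [||_ [r nSr ->] rmax] := @ideal_max F.
- by move=> _ [r _ ->]; apply: colon_ideal.
- by exists [set s | S (s *: (1 *: w))]; exists 1; rewrite ?scale1r.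
exists r => //; split; first exact: colon_ideal.
  by rewrite /= scale1r.
move=> x y /= Sxy; have [Sy|nSy] := pselect (S (y *: (r *: w))); [by right|left].
apply: (rmax [set s | S (s *: ((y * r) *: w))]).
- by exists (y * r); rewrite // -scalerA.
- move=> s /= Ss; rewrite -scalerA scalerA mulrC -scalerA.
  exact: submoduleZ.
- by rewrite /= -scalerA scalerA.
Qed.

Lemma reduced_sqr0 (x : R) : reduced R -> x * x = 0 -> x = 0.
Proof. by move=> Rred xx; apply: (Rred x 2); rewrite expr2. Qed.

(* In a reduced ring ann (a + c) = ann a /\ ann c as soon as a c = 0, so an
   element of I whose annihilator is minimal is a nonzerodivisor. *)
Lemma ideal_nonzerodivisor (I : set R) : reduced R -> is_ideal I ->
  (exists2 x, I x & nonzerodivisor x) \/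
  (exists2 u : R, u <> 0 & forall x, I x -> u * x = 0).
Proof.
move=> Rred [I0 ID IM].
(* The double annihilator reverses the order, so the ascending chain condition yields a minimal
   annihilator. *)
pose ann2 (a : R) : set R := [set t | forall s, s * a = 0 -> s * t = 0].
have [||_ [a Ia ->] amax] := @ideal_max [set K | exists2 a, I a & K = ann2 a].
- move=> _ [a _ ->]; split=> [s _|x y Kx Ky s sa|t x Kx s sa].
  + by rewrite mulr0.
  + by rewrite mulrDr Kx ?Ky ?addr0.
  + by rewrite mulrCA Kx ?mulr0.
- by exists (ann2 0); exists 0.
have [kill|nkill] :=
  pselect (exists2 u : R, u <> 0 & forall x, I x -> u * x = 0); [by right|left].
exists a => // s as0; apply: contrapT => s0; apply: nkill; exists s => // b Ib.
apply: contrapT => sb0; pose c := s * b.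
have Ic : I c by apply: IM.
have ac : c * a = 0 by rewrite mulrAC [s * a]mulrC as0 mul0r.
have annac t : t * (a + c) = 0 -> t * a = 0.
  move=> tac; apply: reduced_sqr0 => //.
  have : t * (a + c) * (t * a) = 0 by rewrite tac mul0r.
  by rewrite mulrDr mulrDl [X in _ + X]mulrACA ac mulr0 addr0.
have : ann2 a (a + c).
  apply: (amax (ann2 (a + c))); first by exists (a + c) => //; apply: ID.
    by move=> t ta r rac; apply: ta; apply: annac.
  by move=> t.
move=> /(_ c ac); rewrite mulrDr ac add0r => /reduced_sqr0 -/(_ Rred).
exact: sb0.
Qed.

Variable m : set R.
Hypothesis Rloc : is_local m.

Lemma local_ideal : is_ideal m. Proof. by case: Rloc => -[]. Qed.

Lemma local_not1 : ~ m 1. Proof. by case: Rloc => -[]. Qed.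

Lemma proper_ideal_local (I : set R) : is_ideal I -> ~ I 1 -> I `<=` m.
Proof.
move=> II I1.
have [||n [idn n1 In] nmax] :=
  @ideal_max [set K | [/\ is_ideal K, ~ K 1 & I `<=` K]].
- by move=> K [].
- by exists I; split.
suff <- : n = m by [].
apply: (proj2 Rloc); split=> // K IK K1 nK.
apply/seteqP; split=> //; apply: nmax => //; split=> //.
exact: subset_trans nK.
Qed.

Lemma local_unit (x : R) : ~ m x -> exists y, x * y = 1.
Proof.
move=> nmx; apply: contrapT => nox; apply: nmx.
apply: (@proper_ideal_local [set z | exists y, z = x * y]).
- split=> [|_ _ [y ->] [z ->]|a _ [y ->]].
  + by exists 0; rewrite mulr0.
  + by exists (y + z); rewrite mulrDr.
  + by exists (a * y); rewrite mulrCA.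
- by case=> y xy; apply: nox; exists y.
- by exists 1; rewrite mulr1.
Qed.

(** The products of powers of [x] with elements outside [q] form a multiplicative set avoiding zero.
    An ideal maximal among those disjoint from it is prime, lies in [q] and misses [x]. *)
Lemma prime_contains_smaller (q : set R) (x : R) :
  is_prime_ideal q -> q x -> nonzerodivisor x ->
  exists2 p, is_prime_ideal p & p `<` q.
Proof.
move=> [Iq q1 qP] qx xnzd.
pose D s := exists k t, ~ q t /\ s = x ^+ k * t.
have xk k t : x ^+ k * t = 0 -> t = 0.
  elim: k => [|k IH]; first by rewrite mul1r.
  by rewrite exprS -mulrA => /xnzd /IH.
have DM s t : D s -> D t -> D (s * t).
  move=> [k [a [qa ->]]] [l [b [qb ->]]].
  by exists (k + l)%N, (a * b); rewrite exprD mulrACA; split=> // /qP[].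
have D_notq t : ~ q t -> D t by move=> qt; exists 0%N, t; rewrite mul1r.
have Dx : D x by exists 1%N, 1; rewrite expr1 mulr1.
have [||p [Ip pD] pmax] := @ideal_max [set K | is_ideal K /\ forall s, K s -> ~ D s].
- by move=> K [].
- exists [set 0]; split.
    by split=> // [y z -> ->|a y ->]; rewrite ?addr0 ?mulr0.
  move=> _ -> [k [t [qt /esym/xk t0]]]; apply: qt; rewrite t0.
  by case: Iq.
have meetsD y : ~ p y -> exists a b, p a /\ D (a + b * y).
  move=> npy; apply: contrapT => noab; apply: npy.
  have [p0 pA pM] := Ip.
  apply: (pmax [set z | exists a b, p a /\ z = a + b * y]).
  - split; last by move=> _ [a [b [pa ->]]] Dab; apply: noab; exists a, b.
    split=> [|_ _ [a [b [pa ->]]] [a' [b' [pa' ->]]]|t _ [a [b [pa ->]]]].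
    + by exists 0, 0; rewrite mul0r addr0.
    + by exists (a + a'), (b + b'); rewrite mulrDl addrACA; split=> //; apply: pA.
    + by exists (t * a), (t * b); rewrite mulrDr mulrA; split=> //; apply: pM.
  - by move=> a pa; exists a, 0; rewrite mul0r addr0.
  - by exists 0, 1; rewrite mul1r add0r.
exists p.
  split=> // [p1|y z pyz]; first by apply: (pD 1) => //; apply: D_notq.
  apply: contrapT => /not_orP[/meetsD[a [b [pa Dy]]] /meetsD[c [d [pc Dz]]]].
  apply: (pD _ _ (DM _ _ Dy Dz)); case: (Ip) => p0 pA pM.
  rewrite mulrDl; apply: (pA); first by rewrite mulrC; apply: pM.
  rewrite mulrDr; apply: (pA); first exact: pM.
  by rewrite mulrACA; apply: pM.
split; last by move=> /(_ x qx) px; apply: (pD x).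
by move=> s ps; apply: contrapT => /D_notq; apply: pD.
Qed.

Hypothesis Rdim1 : krull_dim R 1.

(** Otherwise a prime strictly below [q] starts a chain of length two ending in [m]. *)
Lemma prime_nonzerodivisor_max (q : set R) (x : R) :
  is_prime_ideal q -> q x -> nonzerodivisor x -> q = m.
Proof.
move=> qP qx xnzd; apply: contrapT => qm.
have [p pP pq] := prime_contains_smaller qP qx xnzd.
have qlem : q `<=` m by case: qP => Iq q1 _; apply: proper_ideal_local.
have mP : is_prime_ideal m.
  have [mI m1 _] := proj1 Rloc; split=> // y z myz.
  apply: contrapT => /not_orP[/local_unit[y' yy'] /local_unit[z' zz']].
  apply: m1; have -> : 1 = y' * z' * (y * z).
    by rewrite mulrACA [y' * y]mulrC yy' [z' * z]mulrC zz' mulr1.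
  by case: mI => _ _; apply.
have [_ /(_ 2%N (fun i => match i with 0 => p | 1 => q | _ => m end))] := Rdim1.
suff H : prime_chain 2 (fun i => match i with 0 => p | 1 => q | _ => m end).
  by move=> /(_ H).
split=> [[|[|i]]|[|[|i]]] //= _.
by split=> // mq; apply: qm; apply/seteqP.
Qed.

Hypothesis Rred : reduced R.

(** Otherwise some [u <> 0] kills [m]; by reducedness [u] is not in [m], hence is a unit, so
    [m = 0], against dimension one. *)
Lemma exists_nonzerodivisor : exists2 x, m x & nonzerodivisor x.
Proof.
have [//|[u u0 um]] := ideal_nonzerodivisor Rred local_ideal.
have /local_unit[v uv] : ~ m u.
  by move=> /um /reduced_sqr0 -/(_ Rred).
have m0 x : m x -> x = 0.
  by move=> /um ux; rewrite -[x]mul1r -uv mulrAC ux mul0r.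
have [[p [pP /(_ 0%N isT)[_ p01]]] _] := Rdim1; case: p01 => x px.
have [[p00 _ _] _ _] := pP 0%N isT; have [Ip1 p11 _] := pP 1%N isT.
by rewrite (m0 x) //; apply: (proper_ideal_local Ip1).
Qed.

(* Every prime is an associated prime of R / x with x = 0 or x regular. *)
Lemma prime_principal_colon (p : set R) : is_prime_ideal p ->
  exists x u, (x = 0 \/ nonzerodivisor x) /\
    forall s, p s <-> exists t, s * u = x * t.
Proof.
move=> pP; have [Ip p1 pM] := pP.
have [[x px xnzd]|[u u0 up]] := ideal_nonzerodivisor Rred Ip.
  pose S : set (R^o : lmodType R) := [set y | exists t, y = x * t].
  have SS : submodule S.
    split; first by exists 0; rewrite mulr0.
    by move=> a _ _ [s ->] [t ->]; exists (a * s + t); rewrite mulrDr mulrCA.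
  have nS1 : ~ S 1.
    move=> [t xt]; apply: p1; rewrite xt mulrC.
    by case: Ip => _ _; apply.
  have [r nSr qP] := prime_colon SS nS1.
  exists x, r; split; first by right.
  have -> : p = m by apply: prime_nonzerodivisor_max pP px xnzd.
  rewrite -(prime_nonzerodivisor_max qP (x := x)) //.
    by move=> s /=; rewrite /GRing.scale /= mulr1.
  by exists (r *: (1 : R^o)); rewrite /GRing.scale.
exists 0, u; split; first by left.
move=> s; split=> [/up us|[t]]; first by exists 0; rewrite mulr0 mulrC.
rewrite mul0r => su; apply: contrapT => nps; apply: u0.
have : p u; last by move=> /up /reduced_sqr0; apply.
by have [||] // := pM s u; rewrite su; case: Ip.
Qed.

End Noetherian.

(** * Cosyzygies in an injective resolution of finite length *)

Section InjectiveResolution.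
Variables (R : comNzRingType) (m : set R).
Hypotheses (noethR : noetherian R) (Rloc : is_local m).
Hypotheses (Rdim1 : krull_dim R 1) (Rred : reduced R).
Variables (J : nat -> lmodType R) (d : forall i, {linear J i -> J i.+1}).
Hypothesis injJ : forall i, is_injective (J i).
Hypothesis dP : forall i y, d i.+1 y = 0 <-> exists x, y = d i x.

(* For i >= 1 this is the injectivity of the cosyzygy Z_i = ker d_i, stated
   as Ext^1(V / S, Z_i) = 0. *)
Definition cosyzygy_injective i := forall (V : lmodType R) (S : set V)
    (c : {linear V -> J i}),
  noetherian_module V -> submodule S -> (forall s, S s -> d i (c s) = 0) ->
  exists2 c' : {linear V -> J i},
    (forall v, d i (c' v) = d i (c v)) & (forall s, S s -> c' s = 0).

(** The cosyzygy is the image of the injective [J i], and injectives are divisible by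
    nonzerodivisors. *)
Lemma cosyzygy_divisible i x y : (x = 0 \/ nonzerodivisor x) ->
  d i.+1 (x *: y) = 0 -> exists2 z, d i.+1 z = 0 & x *: z = x *: y.
Proof.
move=> [->|xnzd]; first by exists 0; rewrite ?linear0 // !scale0r.
move=> /dP[w xyw].
have [||h _ hx] := @injective_extend_colon R (J i) R^o [set 0] x w (@injJ i).
- exact: submodule0.
- by move=> s /= sx0; rewrite (xnzd s) ?scale0r // mulrC.
exists (d i (h (1 : R^o))); first by apply/dP; exists (h (1 : R^o)).
by rewrite -!linearZ xyw -hx; congr (d i (h _)); apply: mulr1.
Qed.

(** With p the ideal of all [s] such that [s * u] lies in [x R], this is Ext^1(R / p, Z_(i+1)) = 0.
    Multiplication by [u] embeds R / p in R / x; the map R / p -> Z_(i+2) given by [d i.+1 j]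
    extends to R / x, and divisibility lifts it to [J i.+1]. *)
Lemma cosyzygy_injective_principal i x u (j : J i.+1) :
  cosyzygy_injective i.+2 -> (x = 0 \/ nonzerodivisor x) ->
  (forall s t, s * u = x * t -> s *: d i.+1 j = 0) ->
  exists2 y, d i.+1 y = d i.+1 j & forall s t, s * u = x * t -> s *: y = 0.
Proof.
move=> IH x0 pj.
have SK : submodule ([set a | exists t, a = x * t] : set R^o).
  split; first by exists 0; rewrite mulr0.
  by move=> a _ _ [s ->] [t ->]; exists (a * s + t); rewrite mulrDr mulrCA.
have [|h hx hu] := @injective_extend_colon R (J i.+2) R^o _ u (d i.+1 j) (@injJ _) SK.
- by move=> s [t /pj].
pose S : set R^o := [set a | exists s t, a = x * t + s * u].
have [|||h' dh' h'S] := IH R^o S h.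
- exact: regular_noetherian.
- split; first by exists 0, 0; rewrite mulr0 mul0r addr0.
  move=> a _ _ [s [t ->]] [s' [t' ->]]; exists (a * s + s'), (a * t + t').
  by rewrite /GRing.scale /= !mulrDr !mulrDl !mulrA [x * a]mulrC addrACA.
- move=> _ [s [t ->]]; rewrite linearD (hx (x * t)) ?add0r; last by exists t.
  by rewrite (linearZ_LR h s u) hu -linearZ; apply/dP; exists (s *: j).
(* Subtracting [h'] moves the value into the cosyzygy; [x] kills [z] because [h] and [h'] both
   vanish at [x]. *)
pose z := h (1 : R^o) - h' (1 : R^o).
have aE a : a *: z = h (a : R^o) - h' (a : R^o).
  by rewrite scalerBr -!linearZ; congr (h _ - h' _); apply: mulr1.
have /dP[y zy] : d i.+2 z = 0 by rewrite linearB dh' subrr.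
have [|z' dz' xz'] := @cosyzygy_divisible i x y x0.
  rewrite linearZ -zy; apply: etrans (aE x) _.
  rewrite hx ?h'S ?subr0 //; first by exists 0, 1; rewrite mulr1 mul0r addr0.
  by exists 1; rewrite mulr1.
exists (u *: (y - z')).
  rewrite linearZ linearB dz' subr0 -zy; apply: etrans (aE u) _.
  rewrite hu h'S ?subr0 //; exists 1, 0; by rewrite mulr0 mul1r add0r.
move=> s t su; rewrite scalerA su mulrC -scalerA scalerBr xz' subrr.
exact: scaler0.
Qed.

(* Baer's argument; a maximal extension is enlarged along a prime colon
   ideal, which embeds R / p into some R / x. *)
Lemma cosyzygy_injective_pred i :
  cosyzygy_injective i.+2 -> cosyzygy_injective i.+1.
Proof.
move=> IH V S c noethV SS cS.
pose good (S' : set V) := [/\ submodule S', S `<=` S' &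
  exists2 c' : {linear V -> J i.+1}, (forall v, S v -> c' v = c v) &
    forall s, S' s -> d i.+1 (c' s) = 0].
have [||S' [SS' sSS' [c' c'c c'S']] S'max] := @noetherian_module_max R V good noethV.
- by move=> S' [].
- by exists S; split=> //; exists c.
have S'T v : S' v.
  apply: contrapT => /(prime_colon noethR SS')[r nSb].
  move: (r *: v) nSb => b nSb /(prime_principal_colon noethR Rloc Rdim1 Rred).
  move=> [x [u [x0 pE]]].
  have [|y dy py] := @cosyzygy_injective_principal i x u (c' b) IH x0.
    move=> s t su; rewrite -!linearZ; apply: c'S'.
    by apply/pE; exists t.
  have [|h hS' hb] := @injective_extend_colon R (J i.+1) V S' b y (@injJ _) SS'.
    by move=> s S'sb; have [t /py] := proj1 (pE s) S'sb.
  (* [c' - h] is good on [S' + R b]: [h] vanishes on [S'], and [h b = y] has the same differential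
     as [c' b]. *)
  apply: nSb; apply: (S'max [set w | exists2 k, S' k & exists s, w = k + s *: b]).
  - split; first split.
    + by exists 0; [case: SS' | exists 0; rewrite scale0r addr0].
    + move=> a _ _ [k Sk [s ->]] [k' Sk' [s' ->]]; exists (a *: k + k').
        by case: SS' => _; apply.
      by exists (a * s + s'); rewrite scalerDr scalerDl scalerA addrACA.
    + move=> w /sSS' S'w; exists w => //; exists 0.
      by rewrite scale0r addr0.
    + exists (c' \- h) => [w Sw|_ [k Sk [s ->]]] /=.
        by rewrite hS' ?subr0 ?c'c //; apply: sSS'.
            rewrite [c' _]linearD [h _]linearD hS' // add0r !linearZ /= hb.
      by rewrite !linearD (c'S' k) // add0r !linearZ linearN /= dy scalerN subrr.
  - by move=> k Sk; exists k => //; exists 0; rewrite scale0r addr0.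
  - by exists 0; [case: SS' | exists 1; rewrite scale1r add0r].
(* The map found agrees with [c] on [S] and has values in the cosyzygy, so the difference is the
   required correction. *)
exists (c \- c') => [v|s Ss] /=; last by rewrite c'c ?subrr.
by rewrite linearB (c'S' v) ?subr0.
Qed.

(** Past the end of the resolution the claim is trivial; descending to index one amounts to
    injective dimension at most one. *)
Lemma cosyzygy_injective1 n :
  (forall i, (n < i)%N -> forall y : J i, y = 0) -> cosyzygy_injective 1.
Proof.
move=> J0.
have : cosyzygy_injective n.+1.
  move=> V S c _ _ _; exists \0 => // v.
  by rewrite [RHS]J0 ?[LHS]J0.
by elim: {J0}n => // n IH /cosyzygy_injective_pred.
Qed.

End InjectiveResolution.

(** * Matrices over a local ring, Nakayama's lemma and minimal covers *)

Section LocalMatrix.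
Variables (R : comNzRingType) (m : set R).
Hypotheses (noethR : noetherian R) (Rloc : is_local m).

Lemma det_congr (I : set R) n (A B : 'M[R]_n) : is_ideal I ->
  (forall i j, I (A i j - B i j)) -> I (\det A - \det B).
Proof.
move=> [I0 ID IM] IAB; rewrite /determinant -sumrB.
apply: big_ind => // s _; rewrite -mulrBr; apply: (IM).
apply: (big_rec2 (fun x y => I (x - y))); first by rewrite subrr.
move=> i x y _ Ixy.
have -> : A i (s i) * x - B i (s i) * y = A i (s i) * (x - y) + y * (A i (s i) - B i (s i)).
  by rewrite !mulrBr addrA [y * A _ _]mulrC subrK [y * _]mulrC.
by apply: ID; apply: IM.
Qed.

(** The determinant is congruent to 1 modulo [m], hence a unit; use the adjugate. *)
Lemma sub1_local_invertible n (P : 'M[R]_n) : (forall i j, m (P i j)) ->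
  exists Q, Q *m (1%:M - P) = 1%:M.
Proof.
move=> mP; have mI := local_ideal Rloc; have [m0 mD mM] := mI.
have : m (\det (1%:M - P) - \det (1%:M : 'M[R]_n)).
  apply: det_congr => // i j; rewrite !mxE addrAC subrr sub0r -mulN1r.
  exact: mM.
rewrite det1 => mdet.
have [|c cE] := local_unit noethR Rloc (x := \det (1%:M - P)).
  move=> mdet'; apply: (local_not1 Rloc).
  rewrite -(subrK (\det (1%:M - P)) 1); apply: mD => //.
  by rewrite -opprB -mulN1r; apply: mM.
by exists (c *: \adj (1%:M - P)); rewrite -scalemxAl mul_adj_mx scale_scalar_mx mulrC cE.
Qed.

(** Determinant trick: writing each generator as [x] times a combination of generators gives a
    matrix [P] over [m] such that [f] kills every [z *m (1%:M - P)], that is, everything. *)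
Lemma local_nakayama (V : lmodType R) (x : R) : fin_gen V -> m x ->
  (forall v : V, exists w, v = x *: w) -> forall v : V, v = 0.
Proof.
move=> [n [f fS]] mx Vx.
have /choice[a aE] (i : 'I_n) : exists a, f (delta_mx 0 i) = x *: f a.
  by have [w ->] := Vx (f (delta_mx 0 i)); have [a <-] := fS w; exists a.
pose P : 'M[R]_n := x *: \matrix_i a i.
have [|Q QP] := @sub1_local_invertible n P.
  by move=> i j; rewrite !mxE; case: (local_ideal Rloc) => _ _ mM; rewrite mulrC; apply: mM.
have fP z : f (z *m P) = f z.
  rewrite {2}(row_sum_delta z) mulmx_sum_row !linear_sum.
  by apply: eq_bigr => i _; rewrite !linearZ /= aE rowK !linearZ.
move=> v; have [z <-] := fS v.
rewrite -[z]mulmx1 -QP mulmxA mulmxBr mulmx1 linearB fP.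
exact: subrr.
Qed.

(* The complementary idempotent of a splitting of p has its entries in m. *)
Lemma split_minimal_free (M : lmodType R) n (p : {linear 'rV[R]_n -> M})
    (b : {linear M -> 'rV[R]_n}) :
  (forall z, p z = 0 -> forall j, m (z 0 j)) -> (forall v, p (b v) = v) ->
  is_free M.
Proof.
move=> pmin pb; exists n, p; exists b => // z.
pose P : 'M[R]_n := \matrix_i (delta_mx 0 i - b (p (delta_mx 0 i))).
have PE y : y *m P = y - b (p y).
  rewrite [in RHS](row_sum_delta y) mulmx_sum_row !linear_sum -big_split.
  by apply: eq_bigr => i _; rewrite /= rowK scalerBr !linearZ /= ?scalerN.
have [|Q QP] := @sub1_local_invertible n P.
  by move=> i j; rewrite mxE; apply: pmin; rewrite linearB pb subrr.
have PP : (1%:M - P) *m P = 0.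
  apply/row_matrixP => i; rewrite row_mul row0 PE rowE mulmxBr mulmx1 PE.
  by rewrite subKr pb subrr.
have : P = 0 by rewrite -[P]mul1mx -QP -mulmxA PP mulmx0.
move=> P0; apply/eqP; rewrite eq_sym -subr_eq0 -PE P0 mulmx0.
exact: eqxx.
Qed.

End LocalMatrix.

(** * Splitting a free cover up to a nonzerodivisor *)

Section GenericSection.
Variable R : comNzRingType.
Hypotheses (noethR : noetherian R) (Rred : reduced R).

(** For surjective [p], these are the [r] such that r id lies in the image of M^* (x) M in End M. *)
Definition split_ideal (M : lmodType R) n (p : {linear 'rV[R]_n -> M}) : set R :=
  [set r | exists b : {linear M -> 'rV[R]_n}, forall v, p (b v) = r *: v].

Lemma split_ideal_ideal (M : lmodType R) n (p : {linear 'rV[R]_n -> M}) :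
  is_ideal (split_ideal p).
Proof.
split=> [|x y [b bE] [c cE]|a x [b bE]].
- by exists \0 => v; rewrite linear0 scale0r.
- by exists (b \+ c) => v /=; rewrite linearD bE cE scalerDl.
- by exists (a \*: b) => v /=; rewrite linearZ bE /= scalerA.
Qed.

(* At a prime p = ann u the module u M is torsionfree over the domain R / p;
   a maximal independent family of generators spans it up to some s not in p. *)
Lemma generic_section (M : lmodType R) n (p : {linear 'rV[R]_n -> M}) :
  surjective_map p -> exists2 r, split_ideal p r & nonzerodivisor r.
Proof.
move=> pS; have [//|[w w0 wI]] := ideal_nonzerodivisor noethR Rred (split_ideal_ideal p).
have [r nru pP] := @prime_colon R noethR R^o [set 0] w (submodule0 _) w0.
set u := r *: (w : R^o) in nru pP.
pose supp (A : {set 'I_n}) (c : 'rV[R]_n) := forall i, i \notin A -> c 0 i = 0.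
(* Independence over R / ann u: [u *: c = 0] says that all entries of [c] lie in ann u. *)
pose indep A := forall c, supp A c -> u *: p c = 0 -> u *: c = 0.
have indep0 : indep finset.set0.
  move=> c c0 _; have -> : c = 0 by apply/rowP => i; rewrite mxE c0 ?inE.
  exact: scaler0.
have [A /maxsetP[/asboolP indA Amax] _] :=
  @maxset_exists _ (fun A => `[< indep A >]) _ (asboolT indep0).
have step (j : 'I_n) : exists s, s * u <> 0 /\
    exists2 c, supp A c & (s * u) *: p (delta_mx 0 j) = u *: p c.
  have [jA|jA] := boolP (j \in A).
    exists 1; rewrite mul1r; split=> //; exists (delta_mx 0 j) => // i iA.
    rewrite mxE /=; case: eqP => // ij; by rewrite ij jA in iA.
  have /existsNP[c /not_implyP[cA /not_implyP[pc0 uc0]]] : ~ indep (j |: A)%SET.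
    move=> /asboolT indjA.
    by have /setP/(_ j) := Amax _ indjA (finset.subsetUr _ _); rewrite !inE eqxx (negPf jA).
  pose c' := c - c 0 j *: delta_mx 0 j.
  have c'A : supp A c'.
    move=> i iA; rewrite !mxE /=; case: eqP => [->|/eqP ij].
      by rewrite mulr1 subrr.
    by rewrite mulr0 subr0 cA // !inE negb_or ij.
  have pc' : u *: p c' = - ((c 0 j * u) *: p (delta_mx 0 j)).
    by rewrite linearB linearZ /= scalerBr pc0 sub0r scalerA mulrC.
  exists (c 0 j); split.
    move=> cu0; apply: uc0; rewrite -(subrK (c 0 j *: delta_mx 0 j) c) scalerDr.
    rewrite scalerA [u * _]mulrC cu0 scale0r addr0; apply: indA => //.
    by rewrite pc' cu0 scale0r oppr0.
  exists (- c') => [i iA|]; first by rewrite mxE c'A ?oppr0.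
  by rewrite linearN scalerN pc' opprK.
have [s sP] := choice step.
(* No [s j] lies in the prime ann u, hence neither does [t], which serves all generators at once. *)
pose t := \prod_j s j.
have tu0 : t * u <> 0.
  have [_ _ pM] := pP; rewrite /t; move: (index_enum _) => l.
  elim: l => [|j l IH]; first by rewrite big_nil mul1r.
  by rewrite big_cons => /pM[]; [case: (sP j) | ].
have tuc z : exists2 c, supp A c & (t * u) *: p z = u *: p c.
  have /choice[c cE] (j : 'I_n) : exists c, supp A c /\
      (t * u) *: p (delta_mx 0 j) = u *: p c.
    have [_ [c cA cE]] := sP j; pose a := \prod_(i | i != j) s i.
    exists (a *: c); split=> [i iA|]; first by rewrite mxE cA ?mulr0.
    rewrite /t (bigD1 j) //= -/a mulrAC mulrC -scalerA cE.
    by rewrite [p (_ *: _)]linearZ /= !scalerA mulrC.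
  exists (\sum_j z 0 j *: c j) => [i iA|].
    by rewrite summxE big1 // => j _; rewrite mxE (proj1 (cE j)) ?mulr0.
  rewrite {1}(row_sum_delta z) !linear_sum; apply: eq_bigr => j _ /=.
  rewrite ![p (_ *: _)]linearZ /= scalerA mulrC -scalerA (proj2 (cE j)).
  by rewrite !scalerA [u * _]mulrC.
pose G (v : M) (y : 'rV[R]_n) :=
  exists c, [/\ supp A c, y = u *: c & (t * u) *: v = u *: p c].
have [|||b bG] := @linear_of_rel R M 'rV[R]_n G.
- move=> v; have [z <-] := pS v; have [c cA cE] := tuc z.
  by exists (u *: c), c.
- move=> a v _ v' _ [c [cA -> cE]] [c' [cA' -> cE']].
  exists (a *: c + c'); split.
  + by move=> i iA; rewrite !mxE cA ?cA' // mulr0 addr0.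
  + by rewrite scalerDr !scalerA [a * u]mulrC.
  + rewrite scalerDr cE' scalerA mulrC -scalerA cE linearD [p (_ *: _)]linearZ /=.
    by rewrite scalerDr !scalerA [a * u]mulrC.
- by move=> _ [c [cA -> /esym]]; rewrite scaler0 => /indA; apply.
(* [w] kills the split ideal and [u] is a multiple of [w], so [t * u] squares to zero, against
   reducedness. *)
have /wI wtu : split_ideal p (t * u).
  by exists b => v; have [c [_ -> cE]] := bG v; rewrite linearZ.
case: tu0; apply: reduced_sqr0 => //.
rewrite {2}/u /GRing.scale /= mulrC -!mulrA wtu.
by rewrite !mulr0.
Qed.

End GenericSection.

(** * Free resolutions prolonging a given presentation, and Ext^2 *)

Section FreeResolution.
Variable R : comNzRingType.
Hypothesis noethR : noetherian R.

Lemma exists_syzygy b a (A : 'M[R]_(b, a)) : exists N : {n & 'M[R]_(n, b)},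
  forall w : 'rV_b, w *m A = 0 <-> exists v, w = v *m projT2 N.
Proof.
have [|n [g SE]] := @rV_noetherian R noethR b [set w | w *m A = 0].
  split=> [|c x y /= xA yA]; first exact: mul0mx.
  by rewrite mulmxDl -scalemxAl xA yA scaler0 addr0.
exists (existT _ n (\matrix_i g i)) => w /=.
have vE (v : 'rV_n) : v *m \matrix_i g i = \sum_i v 0 i *: g i.
  by rewrite mulmx_sum_row; apply: eq_bigr => i _; rewrite rowK.
split=> [wA|[v ->]].
  have : [set w | w *m A = 0] w by [].
  rewrite SE => -[c ->]; exists (\row_i c i); rewrite vE.
  by apply: eq_bigr => i _; rewrite mxE.
suff : [set w | w *m A = 0] (v *m \matrix_i g i) by [].
by rewrite SE vE; exists (v 0).
Qed.

Definition syzygy b a (A : 'M[R]_(b, a)) := projT1 (cid (exists_syzygy A)).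

Lemma syzygyP b a (A : 'M[R]_(b, a)) (w : 'rV_b) :
  w *m A = 0 <-> exists v, w = v *m projT2 (syzygy A).
Proof. exact: (projT2 (cid (exists_syzygy A))). Qed.

(* The source dimension is stored last, so that the source of each map is
   convertible to the target of the next one. *)
Definition presentation := {a & {b & 'M[R]_(b, a)}}.

Fixpoint syzygies (s : presentation) i : presentation :=
  if i is j.+1 then
    let t := syzygies s j in existT _ (projT1 (projT2 t)) (syzygy (projT2 (projT2 t)))
  else s.

Definition syzygies_diff (s : presentation) i :
    {linear 'rV[R]_(projT1 (syzygies s i.+1)) -> 'rV[R]_(projT1 (syzygies s i))} :=
  mulmxr (projT2 (projT2 (syzygies s i))).

Variables (b a : nat) (D : 'M[R]_(a, b)) (T : lmodType R).
Variable q : {linear 'rV[R]_b -> T}.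
Hypothesis q_surj : surjective_map q.
Hypothesis q_ker : forall y, q y = 0 <-> exists w, y = w *m D.

Definition coker_resolution : proj_resolution T :=
  let s : presentation := existT _ b (existT _ a D) in
  @ProjResolution R T (fun i => 'rV[R]_(projT1 (syzygies s i)))
    (syzygies_diff s) q (fun i => @rV_projective R _) q_surj q_ker
    (fun i => syzygyP (projT2 (projT2 (syzygies s i)))).

(** A linear map on the second syzygy ker D, composed with P_2 -> ker D, is a 2-cocycle; being a
    coboundary means extending to P_1 = R^a. The function [f] is total, but only its values on ker D
    matter. *)
Lemma Ext2_zero_extend (N : lmodType R) (f : 'rV[R]_a -> N) :
  Ext_zero 2 T N ->
  (forall c w w', w *m D = 0 -> w' *m D = 0 ->
    f (c *: w + w') = c *: f w + f w') ->
  exists g : {linear 'rV[R]_a -> N}, forall w, w *m D = 0 -> g w = f w.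
Proof.
move=> /(_ coker_resolution) Ext2 fL.
pose d1 := res_diff coker_resolution 1; pose d2 := res_diff coker_resolution 2.
have d1D v : d1 v *m D = 0.
  by have [_] := @res_exactS R T coker_resolution 0 (d1 v); apply; exists v.
have [|h hE] := @linear_of_fun R _ N (fun v => f (d1 v)).
  by move=> c x y; rewrite linearP fL.
have [|g gE] := Ext2 h.
  move=> x; rewrite hE.
  have -> : d1 (d2 x) = 0.
    by have [_] := @res_exactS R T coker_resolution 1 (d2 x); apply; exists x.
  have := fL (-1) 0 0 (mul0mx _ _) (mul0mx _ _).
  by rewrite scaler0 addr0 scaleN1r addNr.
exists g => w wD.
have [/(_ wD)[v wv] _] := @res_exactS R T coker_resolution 0 w.
by rewrite wv -[LHS]gE hE.
Qed.

End FreeResolution.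

(** * Ext^2 of the transpose as an obstruction to extending maps from M^* *)

Section Transpose.
Variables (R : comNzRingType) (m : set R).

Lemma dual_functional n : exists phi : {linear 'rV[R]_n -> HomMod 'rV[R]_n R^o},
  (forall w x, phi w x = (x *m w^T) 0 0) /\ forall h, exists w, h = phi w.
Proof.
have /choice[phi phiE] (w : 'rV[R]_n) :
    exists h : HomMod 'rV[R]_n R^o, forall x, h x = (x *m w^T) 0 0.
  apply: (@linear_of_fun R _ R^o (fun x => (x *m w^T) 0 0)) => c x y.
  by rewrite mulmxDl -scalemxAl !mxE.
have [|psi psiE] := @linear_of_fun R _ (HomMod 'rV[R]_n R^o) phi.
  move=> c w w'; apply: homP => x.
  rewrite phiE linearD linearZ mulmxDr -scalemxAr 2!mxE.
  by rewrite -!phiE.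
exists psi; split=> [w x|h]; first by rewrite psiE.
exists (\row_i h (delta_mx 0 i)); apply: homP => x; rewrite psiE phiE.
rewrite mulmx_sum_row; rewrite {1}(row_sum_delta x) linear_sum summxE.
by apply: eq_bigr => i _; rewrite linearZ /= !mxE.
Qed.

(* The dual condition on w says that z |-> z . w factors through p, so these
   w form the module M^* = ker (F^* -> G^* ), of which f is a linear map. *)
Lemma transpose_Ext2_extend (M N T : lmodType R) : noetherian R ->
  is_transpose m M T -> Ext_zero 2 T N ->
  exists n (p : {linear 'rV[R]_n -> M}), [/\ surjective_map p,
    forall z, p z = 0 -> forall j, m (z 0 j) &
    let dual (w : 'rV[R]_n) := forall z, p z = 0 -> z *m w^T = 0 in
    forall f : 'rV[R]_n -> N,
      (forall c w w', dual w -> dual w' -> f (c *: w + w') = c *: f w + f w') ->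
      exists g : {linear 'rV[R]_n -> N}, forall w, dual w -> g w = f w].
Proof.
move=> noethR [a [b [u [p [pS pu pmin _ [q [qS qker]]]]]]] Ext2.
exists a, p; split=> // dual f fL.
have [phib [phibE phibS]] := dual_functional b.
have [phia [phiaE phiaS]] := dual_functional a.
(* In coordinates, [w |-> w *m D] is the dual map F^* -> G^* of [u]. *)
pose D : 'M[R]_(a, b) := \matrix_(i, j) u (delta_mx 0 j) 0 i.
have uE x : u x = x *m D^T.
  rewrite mulmx_sum_row {1}(row_sum_delta x) linear_sum.
  apply: eq_bigr => j _; rewrite linearZ; congr (_ *: _).
  by apply/rowP => i; rewrite !mxE.
have phiD w x : phib (w *m D) x = phia w (u x).
  by rewrite phibE phiaE uE trmx_mul mulmxA.
have dualP w : w *m D = 0 <-> dual w.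
  split=> [wD z /pu[x ->]|dw].
    by rewrite uE -mulmxA -trmx_mul wD trmx0 mulmx0.
  apply/rowP => j; have /dw : p (u (delta_mx 0 j)) = 0.
    by apply/pu; exists (delta_mx 0 j).
  rewrite uE -mulmxA -trmx_mul => /matrixP/(_ 0 0).
  by rewrite -rowE !mxE.
have [|||g gE] := @Ext2_zero_extend R noethR b a D T (q \o phib) _ _ N f Ext2.
- by move=> t; have [h <-] := qS t; have [w ->] := phibS h; exists w.
- move=> y /=; rewrite qker; split=> [[h hE]|[w ->]].
    have [w hw] := phiaS h; exists w; apply/rowP => j.
    have := hE (delta_mx 0 j); rewrite hw -phiD !phibE.
    by rewrite -!rowE !mxE.
  by exists (phia w) => x; rewrite phiD.
- by move=> c w w' /dualP dw /dualP dw'; apply: fL.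
by exists g => w /dualP; apply: gE.
Qed.

End Transpose.

(** * Torsionfreeness and socle elements of maximal Cohen-Macaulay modules in dimension one *)

Section Canonical.
Variables (R : comNzRingType) (m : set R).
Hypotheses (noethR : noetherian R) (Rloc : is_local m).
Hypotheses (Rdim1 : krull_dim R 1).
Variable omega : lmodType R.
Hypothesis omega_mcm : max_CohenMacaulay m omega.

Lemma mcm_regular : exists2 x, m x & forall w : omega, x *: w = 0 -> w = 0.
Proof.
have [_ [d [_ dmax] [[s [sd sm [sreg _]]] _]]] := omega_mcm.
have d0 : (0 < size s)%N.
  by have [[p /dmax]] := Rdim1; rewrite sd.
exists s`_0; first by apply/sm/mem_nth.
move=> w xw; have := sreg 0%N d0 w; rewrite take0 xw.
case; first by exists (fun=> 0); rewrite big_ord0.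
by move=> g ->; rewrite big_ord0.
Qed.

(** An associated prime containing a nonzerodivisor would be [m], but [m] contains an element
    regular on [omega]. *)
Lemma mcm_torsionfree : torsionfree omega.
Proof.
move=> x w xnzd xw; apply: contrapT => w0.
have [r nrw rP] := prime_colon noethR (submodule0 omega) w0.
have rm : [set s | [set 0] (s *: (r *: w))] = m.
  apply: (prime_nonzerodivisor_max noethR Rloc Rdim1 rP _ xnzd) => /=.
  by rewrite scalerA mulrC -scalerA xw scaler0.
have [y my yreg] := mcm_regular; apply: nrw; apply: yreg.
by move: my; rewrite -rm.
Qed.

(** By Nakayama [omega / x omega] is nonzero; an associated prime of it contains [x], so it is
    [m]. *)
Lemma mcm_socle x : m x -> nonzerodivisor x ->
  exists2 w : omega, ~ (exists w', w = x *: w') &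
    forall s, m s -> exists w', s *: w = x *: w'.
Proof.
move=> mx xnzd.
pose S : set omega := [set w | exists w', w = x *: w'].
have SS : submodule S.
  split; first by exists 0; rewrite scaler0.
  move=> c _ _ [v ->] [w ->]; exists (c *: v + w).
  by rewrite scalerDr !scalerA mulrC.
have [w nSw] : exists w, ~ S w.
  apply: contrapT => /forallNP nS.
  have [fg [d _ [[s [_ _ [_ [c nc]]]] _]]] := omega_mcm.
  apply: nc; rewrite (local_nakayama noethR Rloc fg mx _ c).
    by exists (fun=> 0); rewrite big1 // => i _; rewrite scaler0.
  by move=> v; apply: contrapT; apply: nS.
have [r nSr rP] := prime_colon noethR SS nSw.
exists (r *: w) => // s ms; move: (ms).
rewrite -(prime_nonzerodivisor_max noethR Rloc Rdim1 rP _ xnzd) //=.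
by exists (r *: w).
Qed.

End Canonical.

(** * The identity of M factors through its free cover *)

Section Descent.
Variables (R : comNzRingType) (m : set R).
Hypotheses (noethR : noetherian R) (Rloc : is_local m).
Hypotheses (Rdim1 : krull_dim R 1) (Rred : reduced R).
Variable omega : lmodType R.
Hypothesis omega_mcm : max_CohenMacaulay m omega.
Variables (J : nat -> lmodType R) (d : forall i, {linear J i -> J i.+1}).
Variables (e : {linear omega -> J 0%N}) (len : nat).
Hypothesis injJ : forall i, is_injective (J i).
Hypothesis J_len : forall i, (len < i)%N -> forall y : J i, y = 0.
Hypothesis e_inj : injective e.
Hypothesis d0P : forall y, d 0%N y = 0 <-> exists x, y = e x.
Hypothesis dP : forall i y, d i.+1 y = 0 <-> exists x, y = d i x.

(* The class of j in Ext^1(R / m, omega) is nonzero. *)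
Lemma residue_ext1_nonzero : exists2 j : J 0%N,
  (forall s, m s -> d 0%N (s *: j) = 0) &
  ~ exists z, forall s, m s -> s *: e z = s *: j.
Proof.
have [x mx xnzd] := exists_nonzerodivisor noethR Rloc Rdim1 Rred.
have [w xw mw] := mcm_socle noethR Rloc Rdim1 omega_mcm mx xnzd.
have xreg := mcm_torsionfree noethR Rloc Rdim1 omega_mcm xnzd.
(* The value at 1 of the extension acts as a fraction w / x in [J 0]. *)
pose G (s : R^o) (y : J 0%N) := exists2 w', y = e w' & s *: w = x *: w'.
have [||| h hE] := @injective_extend_rel R (J 0%N) R^o G (@injJ _).
- by exists 0; rewrite ?scale0r ?scaler0 ?linear0.
- move=> c s _ s' _ [w1 -> sw] [w2 -> sw']; exists (c *: w1 + w2).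
    by rewrite linearP.
  by rewrite scalerDl -scalerA sw sw' scalerDr !scalerA mulrC.
- move=> _ [w' -> /esym]; rewrite scale0r => /xreg ->; exact: linear0.
have hs (s : R) w' : s *: w = x *: w' -> s *: h (1 : R^o) = e w'.
  move=> sw; rewrite -linearZ; apply: hE; exists w' => //.
  by rewrite -sw; congr (_ *: w); apply: mulr1.
exists (h (1 : R^o)) => [s /mw[w' /hs ->]|[z zE]].
  by apply/d0P; exists w'.
apply: xw; exists z; apply: e_inj.
by rewrite [RHS]linearZ /= (zE x mx) (hs x w).
Qed.

(** The map K + R b -> J_0 / omega that kills [K] and sends [b] to the class of [j] extends to R^n,
    as that cosyzygy is injective, and then lifts to [J 0] because R^n is free. *)
Lemma lift_to_J0 n (K : set 'rV[R]_n) (b : 'rV[R]_n) (j : J 0%N) :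
  submodule K -> (forall s, K (s *: b) -> s *: d 0%N j = 0) ->
  exists h : {linear 'rV[R]_n -> J 0%N},
    (forall k, K k -> d 0%N (h k) = 0) /\ d 0%N (h b) = d 0%N j.
Proof.
move=> SK Kj.
have [c cK cb] := injective_extend_colon (@injJ 1) SK Kj.
have dd : d 1%N (d 0%N j) = 0 by apply/dP; exists j.
pose S : set 'rV[R]_n := [set v | exists2 k, K k & exists s, v = k + s *: b].
have [|||c' dc' c'S] := @cosyzygy_injective1 R m noethR Rloc Rdim1 Rred J d injJ dP len J_len _ S c.
- exact: rV_noetherian.
- split; first by exists 0; [case: SK | exists 0; rewrite scale0r addr0].
  move=> a _ _ [k Kk [s ->]] [k' Kk' [s' ->]]; exists (a *: k + k').
    by case: SK => _; apply.
  by exists (a * s + s'); rewrite scalerDr scalerDl scalerA addrACA.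
- move=> _ [k Kk [s ->]].
  by rewrite linearD cK // add0r !linearZ /= cb dd scaler0.
have [|h hE] := @rV_lift R n _ _ (d 0%N) (c \- c').
  move=> z; have [+ _] := @dP 0%N ((c \- c') z).
  case; first by rewrite /= linearB dc' subrr.
  by move=> x xE; exists x; apply: esym xE.
exists h; split=> [k Kk|].
  by rewrite hE /= cK // c'S ?subrr //; exists k => //; exists 0; rewrite scale0r addr0.
rewrite hE /= cb c'S ?subr0 //; exists 0; first by case: SK.
by exists 1; rewrite scale1r add0r.
Qed.

Variable M : lmodType R.
Hypothesis M_tf : torsionfree M.
Variables (n : nat) (p : {linear 'rV[R]_n -> M}).
Hypothesis p_surj : surjective_map p.

Let dual (w : 'rV[R]_n) := forall z, p z = 0 -> z *m w^T = 0.

Hypothesis hom_extend : forall f : 'rV[R]_n -> HomMod M omega,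
  (forall c w w', dual w -> dual w' -> f (c *: w + w') = c *: f w + f w') ->
  exists g : {linear 'rV[R]_n -> HomMod M omega}, forall w, dual w -> g w = f w.

Let x_ i := p (delta_mx 0 i).

(** The [j]-th coordinate of [B] is a functional on [M], recorded by its values at the
    generators. *)
Lemma dual_coord (B : {linear M -> 'rV[R]_n}) j : dual (\row_i B (x_ i) 0 j).
Proof.
move=> z pz0; have Bz : B (p z) = 0 by rewrite pz0 linear0.
rewrite mulmx_sum_row; apply/rowP => k; rewrite ord1 summxE mxE.
have /rowP/(_ j) := Bz; rewrite {1}(row_sum_delta z) !linear_sum summxE mxE; apply: etrans.
by apply: eq_bigr => i _; rewrite !linearZ /= !mxE.
Qed.

(** The endomorphism w (x) y, that is v |-> w(v) y, factors through [p] once [y] is lifted to the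
    cover. *)
Lemma dual_of_functional (w : 'rV[R]_n) (y : M) : dual w ->
  exists B : {linear M -> 'rV[R]_n}, forall i, p (B (x_ i)) = w 0 i *: y.
Proof.
move=> dw; have [y' py'] := p_surj y.
pose G (v : M) (b : 'rV[R]_n) := exists2 z, v = p z & b = (z *m w^T) *m y'.
have [|||B BE] := @linear_of_rel R _ _ G.
- by move=> v; have [z <-] := p_surj v; exists ((z *m w^T) *m y'), z.
- move=> c _ _ _ _ [z -> ->] [z' -> ->]; exists (c *: z + z').
    by rewrite linearP.
  by rewrite mulmxDl mulmxDl -!scalemxAl.
- by move=> _ [z /esym/dw z0 ->]; rewrite z0 mul0mx.
exists B => i; have [z xz ->] := BE (x_ i).
have /dw : p (z - delta_mx 0 i) = 0 by rewrite linearB -xz subrr.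
rewrite mulmxBl => /eqP; rewrite subr_eq0 => /eqP ->.
rewrite -rowE [row i _]mx11_scalar mul_scalar_mx linearZ /= py'.
by rewrite !mxE.
Qed.

(* Theta embeds End M in a free module by values at generators followed by b0,
   K = Theta(T), and Gam restricted to K is the map T -> omega that does not
   extend to r id. *)
Lemma split_ideal1 : split_ideal p 1.
Proof.
have [j dj nj] := residue_ext1_nonzero.
have [r0 [b0 pb0] r0nzd] := generic_section noethR Rred p_surj.
have SI : submodule (split_ideal p : set R^o).
  exact/ideal_submodule/split_ideal_ideal.
apply: contrapT => nI1.
have [r nIr rP] := prime_colon noethR SI nI1.
have rE : r *: (1 : R^o) = r by apply: mulr1.
rewrite rE in nIr rP.
have r0m : split_ideal p (r0 *: (r : R^o)).
  rewrite /GRing.scale /= mulrC; have [_ _ IM] := split_ideal_ideal p.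
  by apply: IM; exists b0.
(* The colon ideal is prime and contains the nonzerodivisor [r0], so it is [m]. *)
have colonm s : split_ideal p (s * r) <-> m s.
  by rewrite -(prime_nonzerodivisor_max noethR Rloc Rdim1 rP r0m r0nzd).
pose Theta (t : 'I_n -> M) : 'rV[R]_(n * n) := mxvec (\matrix_i b0 (t i)).
have ThetaP a t t' : Theta (fun i => a *: t i + t' i) = a *: Theta t + Theta t'.
  rewrite -linearP; congr mxvec; apply/row_matrixP => i.
  by rewrite linearP /= !rowK linearP.
(* [p] after [b0] is multiplication by the nonzerodivisor [r0], and [M] is torsionfree. *)
have Theta_inj t t' : Theta t = Theta t' -> forall i, t i = t' i.
  move=> /(can_inj mxvecK) tt' i.
  have bt : b0 (t i) = b0 (t' i).
    by have /(congr1 (row i)) := tt'; rewrite !rowK.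
  apply/eqP; rewrite -subr_eq0; apply/eqP; apply: (M_tf r0nzd).
  by rewrite scalerBr -!pb0 bt subrr.
pose K : set 'rV[R]_(n * n) := [set v |
  exists B : {linear M -> 'rV[R]_n}, v = Theta (fun i => p (B (x_ i)))].
have ThetaZ a t : Theta (fun i => a *: t i) = a *: Theta t.
  rewrite -linearZ; congr mxvec; apply/row_matrixP => i.
  by rewrite linearZ /= !rowK linearZ.
have Theta0 : Theta (fun=> 0) = 0.
  rewrite -[RHS](scale0r (Theta (fun=> 0))) -ThetaZ; congr Theta.
  by apply: funext => i; rewrite scaler0.
have SK : submodule K.
  split.
    exists \0; rewrite -[RHS]/(Theta (fun=> p 0)) linear0.
    by rewrite Theta0.
  move=> a _ _ [B ->] [B' ->]; exists ((a \*: B) \+ B').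
  rewrite -ThetaP; congr Theta; apply: funext => i /=.
  by rewrite linearP.
pose E := Theta (fun i => r *: x_ i).
have sE s : m s -> exists2 B : {linear M -> 'rV[R]_n},
    forall i, p (B (x_ i)) = (s * r) *: x_ i & s *: E = Theta (fun i => p (B (x_ i))).
  move=> /colonm[B pB]; exists B => [i|]; first exact: pB.
  rewrite -ThetaZ; congr Theta; apply: funext => i.
  by rewrite pB scalerA.
(* If s r id lies in T then [s] is in [m], which kills the class of [j]: sending [E] to that class
   and [K] to zero is consistent. *)
have KE s : K (s *: E) -> s *: d 0%N j = 0.
  move=> [B]; rewrite -ThetaZ => /Theta_inj sB.
  rewrite -linearZ; apply/dj/colonm; exists B => v.
  have [z <-] := p_surj v; rewrite (row_sum_delta z) !linear_sum.
  by apply: eq_bigr => i _; rewrite !linearZ /= -sB -[p (delta_mx 0 i)]/(x_ i) !scalerA mulrA.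
have [Gam [GamK GamE]] := lift_to_J0 SK KE.
(* [f w y] is the value of [Gam] at w (x) y, which lies in [omega] because w (x) y is in T; outside
   [dual] the map [\0] is a placeholder. *)
have /choice[f fE] (w : 'rV[R]_n) : exists f : HomMod M omega,
    dual w -> forall y, e (f y) = Gam (Theta (fun i => w 0 i *: y)).
  have [dw|ndw] := pselect (dual w); last by exists \0.
  have [|||f fE] := @linear_of_rel R M omega
    (fun y o => e o = Gam (Theta (fun i => w 0 i *: y))).
  - move=> y; have [B BE] := dual_of_functional y dw.
    have /GamK/d0P[o oE] : K (Theta (fun i => w 0 i *: y)).
      by exists B; congr Theta; apply: funext => i.
    by exists o.
  - move=> a y o y' o' oE oE'; rewrite linearP oE oE' -linearP -ThetaP.
    congr (Gam (Theta _)); apply: funext => i.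
    by rewrite scalerDr !scalerA mulrC.
  - move=> o oE; apply: e_inj; rewrite oE linear0.
    under [X in Theta X]funext do rewrite scaler0.
    by rewrite Theta0 linear0.
  by exists f.
have [|g gE] := hom_extend (f := f).
  move=> c w w' dw dw'; apply: homP => y; apply: e_inj.
  have dcw : dual (c *: w + w').
    by move=> z pz; rewrite linearP mulmxDr -scalemxAr dw // dw' // scaler0 addr0.
  rewrite fE // -[(c *: f w + f w') y]/(c *: f w y + f w' y) linearP !fE //.
  rewrite -linearP -ThetaP; congr (Gam (Theta _)); apply: funext => i.
  by rewrite !mxE scalerDl scalerA.
(* The value at r id of the extension t |-> sum_i g(delta_i)(t x_i) to End M. *)
pose o : omega := \sum_i g (delta_mx 0 i) (r *: x_ i).
(* For [s] in [m], s r id is the sum of the w_k (x) x_k, with w_k the k-th coordinate of [B]; both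
   sides then become the sum of the [g (w k) (x_ k)]. *)
have so s : m s -> s *: e o = s *: Gam E.
  move=> /sE[B pB sEB]; rewrite -[LHS]linearZ -[RHS](linearZ_LR Gam) sEB.
  pose w k : 'rV[R]_n := \row_i B (x_ i) 0 k.
  have -> : s *: o = \sum_k g (w k) (x_ k).
    have sum_app (I : finType) (F : I -> HomMod M omega) y :
        (\sum_i F i) y = \sum_i F i y.
      apply: (big_ind2 (fun (h : HomMod M omega) v => h y = v)) => //.
      by move=> h _ h' _ <- <-.
    have -> : \sum_k g (w k) (x_ k) =
        \sum_k \sum_i B (x_ i) 0 k *: g (delta_mx 0 i) (x_ k).
      apply: eq_bigr => k _; rewrite {1}(row_sum_delta (w k)) linear_sum sum_app.
      by apply: eq_bigr => i _; rewrite linearZ /= !mxE.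
    rewrite exchange_big scaler_sumr; apply: eq_bigr => i _.
    rewrite -linearZ /= scalerA -pB {1}(row_sum_delta (B (x_ i))) !linear_sum.
    by apply: eq_bigr => k _; rewrite !linearZ.
  have ThetaS (F : 'I_n -> 'I_n -> M) :
      Theta (fun i => \sum_k F k i) = \sum_k Theta (F k).
    rewrite -linear_sum; congr mxvec; apply/row_matrixP => i.
    rewrite rowK linear_sum [RHS]linear_sum; apply: eq_bigr => k _.
    by rewrite /= rowK.
  have -> : Theta (fun i => p (B (x_ i))) =
      \sum_k Theta (fun i => w k 0 i *: x_ k).
    rewrite -ThetaS; congr Theta; apply: funext => i.
    rewrite {1}(row_sum_delta (B (x_ i))) linear_sum; apply: eq_bigr => k _.
    by rewrite linearZ !mxE.
  rewrite !linear_sum; apply: eq_bigr => k _.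
  by rewrite gE ?fE //; apply: dual_coord.
(* [j - Gam E] lies in [omega], and [m] kills [e o - Gam E]; so this element of [omega] agrees with
   [j] under [m], and the class of [j] would vanish. *)
have /d0P[z zE] : d 0%N (j - Gam E + e o) = 0.
  rewrite linearD linearB GamE subrr add0r.
  by apply/d0P; exists o.
apply: nj; exists z => s ms.
by rewrite -zE scalerDr scalerBr so // subrK.
Qed.

End Descent.

Theorem corollary4p9
  (R : comNzRingType) (m : set R)
  (R_noeth : noetherian R) (R_local : is_local m)
  (R_dim1 : krull_dim R 1) (R_red : reduced R)
  (omega : lmodType R) (omega_can : canonical_module m omega)
  (M : lmodType R) (M_fg : fin_gen M) (M_tf : torsionfree M)
  (Ext1_MM : Ext_zero 1 M M)
  (TrM : lmodType R) (TrM_transpose : is_transpose m M TrM)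
  (Ext2_TrM : Ext_zero 2 TrM (HomMod M omega)) :
  is_free M.
Proof.
have [mcm _ [len [J [d [e [injJ Jlen einj d0P dP]]]]]] := omega_can.
have [n [p [pS pmin ext]]] := transpose_Ext2_extend R_noeth TrM_transpose Ext2_TrM.
have [b bE] := split_ideal1 R_noeth R_local R_dim1 R_red mcm injJ Jlen einj
  d0P dP M_tf pS ext.
by apply: (split_minimal_free R_noeth R_local pmin (b := b)) => v; rewrite bE scale1r.
Qed.
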